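(* Let $F$ be a closed relation on a compact metric space $X$ with $Dom(F) = X$ and let $C$ be an isolating neighborhood for $F$. If $C_{+}$ is a nowhere dense subset of $C$, then for any $\epsilon > 0$ there exists a closed relation $G$ on $X$ with $Dom(G) = X$ such that $G \subset V_{\epsilon} \circ F$ and $F \subset V_{\epsilon} \circ G$, but such that there exists a positive integer $N$ with $(G_C)^N = \emptyset$. In particular, with respect to $G$ we have $C_- = C_+ = C_{\pm} = \emptyset$.
   Context: A relation $F$ on $X$ is a subset of $X\times X$, closed if it is a closed subset; $F(x)=\{y:(x,y)\in F\}$, $F(A)=\bigcup_{x\in A}F(x)$, $Dom(F)=\{x:F(x)\ne\emptyset\}$, $F^{-1}=\{(y,x):(x,y)\in F\}$, $G\circ F=\{(x,z): \exists y,\ (x,y)\in F, (y,z)\in G\}$; $F^n$ is the $n$-fold composition, $F^{-n}=(F^{-1})^n$. $V_\epsilon=\{(x,y)\in X\times X:d(x,y)<\epsilon\}$. For a closed relation $F$ and closed $C\subset X$: $F_C=F\cap(C\times C)$; $C_-=\bigcap_{n\ge1}(F_C)^n(C)$, $C_+=\bigcap_{n\ge1}(F_C)^{-n}(C)$, $C_\pm=C_+\cap C_-$. The closed set $C$ is an isolating neighborhood for $F$ if $C_\pm$ is contained in the interior of $C$ in $X$. ''Nowhere dense subset of $C$'' is with respect to the relative topology of $C$ (the set $C_+$ is closed and has empty interior relative to $C$). *)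

(* Defs.v *)
From mathcomp Require Import all_boot all_order all_algebra.
From mathcomp Require Import all_classical all_reals all_analysis.

Set Implicit Arguments.
Unset Strict Implicit.
Unset Printing Implicit Defensive.

Import Order.TTheory GRing.Theory Num.Theory.

Local Open Scope classical_set_scope.
Local Open Scope ring_scope.

Section Relations.
Context {X : Type}.
Implicit Types (F G : set (X * X)) (A C : set X) (n : nat).

Definition rel_image F A : set X := [set y | exists2 x, A x & F (x, y)].

Definition rel_comp G F : set (X * X) :=
  [set xz | exists y, F (xz.1, y) /\ G (y, xz.2)].

Definition rel_inv F : set (X * X) := [set yx | F (yx.2, yx.1)].

Definition rel_pow F n : set (X * X) := iterop n rel_comp F diagonal.

Definition rel_dom F : set X := [set x | rel_image F [set x] !=set0].

Definition rel_restr F C : set (X * X) := F `&` (C `*` C).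

Definition C_minus F C : set X :=
  \bigcap_(n in [set n | (1 <= n)%N]) rel_image (rel_pow (rel_restr F C) n) C.

Definition C_plus F C : set X :=
  \bigcap_(n in [set n | (1 <= n)%N])
    rel_image (rel_pow (rel_inv (rel_restr F C)) n) C.

Definition C_plusminus F C : set X := C_plus F C `&` C_minus F C.

End Relations.

Definition entourage_lt {R : realType} {X : metricType R} (e : R) :
  set (X * X) := [set xy | mdist xy.1 xy.2 < e].

Definition closed_relation {X : topologicalType} (F : set (X * X)) : Prop :=
  closed F.

Definition isolating_neighborhood {X : topologicalType}
    (F : set (X * X)) (C : set X) : Prop :=
  closed C /\ C_plusminus F C `<=` interior C.

Definition nowhere_dense {T : topologicalType} (A : set T) : Prop :=
  interior (closure A) = set0.

(* [subspace C] is the type of X with the relative topology on C and with the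
   points outside C isolated, so that for A included in C the closure and the
   interior of A in [subspace C] are those relative to C. *)
Definition nowhere_dense_in {X : topologicalType} (C A : set X) : Prop :=
  A `<=` C /\ @nowhere_dense (subspace C) A.

(* Main.v *)
Require Import Defs.
From mathcomp Require Import all_boot all_order all_algebra.
From mathcomp Require Import all_classical all_reals all_analysis.

Local Open Scope classical_set_scope.
Local Open Scope ring_scope.

Import Order.TTheory GRing.Theory Num.Theory.

(** Write [P] for the restriction of [F] to [C].  The points of [C_plus F C] are
    those from which [P] has orbits of every finite length, and a point of [C]
    that [P] maps into [C_plus F C] lies there already.  Since [C_plus F C] has
    empty interior in [C], orbits can be kept away from it by small changes.

    A finite set [K] of points of [C] outside [C_plus F C] is an [e / 2]-net of
    [C] ([compact_finite_net]).  By compactness there are [M] and [N] such that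
    no point of [K] starts a [P]-orbit of length [N], and no point of
    [C_plus F C] outside the interior of [C] ends one of length [M]; the latter
    is where isolation enters ([escape_C_plus], [escape_C_minus]).  So
    [C_plus F C] has a closed neighbourhood [Z] avoiding both the first [N]
    forward images of [K] and the points outside the interior of [C] that end
    [P]-orbits of length [M].  A further compactness argument gives an [N'] such
    that no point of [C] outside the interior of [Z] starts a [P]-orbit of
    length [N'].

    The relation [G] is [F], except that arrows ending in the interior of [Z] and
    of [C] are redirected to nearby points of [K] ([redirect]); arrows ending in
    [Z] and [C] may also jump so, which makes [G] closed.  An orbit of [G] in [C]
    jumps at most once, because the [P]-orbits from [K] die before they meet
    [Z].  Before the jump it is a [P]-orbit avoiding the intersection of the two
    interiors, and after [M] steps it therefore avoids the interior of [Z], so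
    that fewer than [N'] steps remain.  Hence orbits of [G] in [C] have bounded
    length ([rel_pow_jump_set0]). *)

(** * Powers of relations *)

#[local] Arguments rel_pow : simpl never.

Section RelationPowers.
Context {X : Type}.
Implicit Types (P Q : set (X * X)) (C K S U : set X) (m n : nat).

Lemma rel_compA P Q (T : set (X * X)) :
  rel_comp T (rel_comp Q P) = rel_comp (rel_comp T Q) P.
Proof.
apply/seteqP; split=> -[x z] /= [y /= [h1 h2]].
  by case: h1 => w [Pxw Qwy]; exists w; split=> //; exists y.
by case: h2 => w [Qyw Twz]; exists w; split=> //; exists y.
Qed.

Lemma rel_comp_diagonal P : rel_comp P diagonal = P.
Proof.
apply/seteqP; split=> -[x z]; first by move=> [y [/= xy]]; rewrite -[y]xy.
by move=> Pxz; exists x.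
Qed.

Lemma diagonal_rel_comp P : rel_comp diagonal P = P.
Proof.
apply/seteqP; split=> -[x z]; first by move=> [y [/= xy yz]]; rewrite -[z]yz.
by move=> Pxz; exists z.
Qed.

Lemma rel_powS P n : rel_pow P n.+1 = rel_comp P (rel_pow P n).
Proof. by case: n => [|n] //; rewrite rel_comp_diagonal. Qed.

Lemma rel_powD P m n : rel_pow P (m + n) = rel_comp (rel_pow P n) (rel_pow P m).
Proof.
elim: n => [|n IHn]; first by rewrite addn0 diagonal_rel_comp.
by rewrite addnS !rel_powS IHn rel_compA.
Qed.

Lemma rel_pow_inv P n : rel_pow (rel_inv P) n = rel_inv (rel_pow P n).
Proof.
elim: n => [|n IHn]; first by apply/seteqP; split=> -[x y].
rewrite rel_powS IHn -addn1 addnC rel_powD.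
by apply/seteqP; split=> -[x z]; rewrite /rel_inv /= => -[y [xy yz]]; exists y.
Qed.

(** Long orbits restrict to shorter ones: the only monotonicity that the
    compactness arguments and the counting of steps rely on. *)
Lemma rel_pow_prefix {P m n x z} :
  rel_pow P (m + n) (x, z) -> exists y, rel_pow P m (x, y).
Proof. by rewrite rel_powD => -[y [xy _]]; exists y. Qed.

Lemma rel_pow_suffix {P m n x z} :
  rel_pow P (m + n) (x, z) -> exists y, rel_pow P n (y, z).
Proof. by rewrite rel_powD => -[y [_ yz]]; exists y. Qed.

Lemma rel_pow_restr {P C n x y} :
  rel_pow (rel_restr P C) n.+1 (x, y) -> C x /\ C y.
Proof.
move=> xy; split.
  by move: xy; rewrite -addn1 addnC rel_powD => -[z [[_ [/= Cx _]] _]].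
by move: xy; rewrite rel_powS => -[z [_ [_ [/= _ Cy]]]].
Qed.

(** Allowing length [0] and forgetting the endpoint condition costs nothing, as a
    step of the restricted relation already ends in [C]; the sets intersected
    here are projections of closed relations. *)
Lemma C_plusE P C :
  C_plus P C = \bigcap_n (fst @` rel_pow (rel_restr P C) n).
Proof.
apply/seteqP; split=> x Cx.
  move=> [|n] _; first by exists (x, x).
  have [y _] := Cx n.+1 isT; rewrite rel_pow_inv => xy.
  by exists (x, y).
move=> [|n] // _; move: Cx => /(_ n.+1 I) [[{}x y] /= xy <-].
by rewrite rel_pow_inv; exists y => //; have [] := rel_pow_restr xy.
Qed.

Lemma C_minusE P C :
  C_minus P C = \bigcap_n (snd @` rel_pow (rel_restr P C) n).
Proof.
apply/seteqP; split=> y Cy.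
  move=> [|n] _; first by exists (y, y).
  by have [x _ xy] := Cy n.+1 isT; exists (x, y).
move=> [|n] // _; move: Cy => /(_ n.+1 I) [[x {}y] /= xy <-].
by exists x => //; have [] := rel_pow_restr xy.
Qed.

Lemma rel_pow_set0_limits {P C n} : rel_pow (rel_restr P C) n = set0 ->
  [/\ C_minus P C = set0, C_plus P C = set0 & C_plusminus P C = set0].
Proof.
move=> P0.
have plus0 : C_plus P C = set0.
  rewrite -subset0 C_plusE => x /(_ n I) [xy].
  by rewrite P0.
have minus0 : C_minus P C = set0.
  rewrite -subset0 C_minusE => y /(_ n I) [xy].
  by rewrite P0.
by split=> //; rewrite /C_plusminus plus0 set0I.
Qed.

(** The counting of steps, free of topology.  Every step of [Q] is a step of [P]
    avoiding [U] or a jump into [K] issued when a step of [P] enters [S].  As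
    [P]-orbits from [K] die before they reach [S], no second jump occurs, so an
    orbit is a [P]-orbit followed by at most one jump and fewer than [N] steps;
    the first part is short because its point number [M.+1], reached by a
    [P]-step, is off [U]. *)
Lemma rel_pow_jump_set0 P Q K S U M N' N :
    (forall x z, Q (x, z) -> (P (x, z) /\ ~ U z) \/
       (K z /\ exists2 y, P (x, y) & S y)) ->
    (forall k y, K k -> ~ rel_pow P N (k, y)) ->
    (forall k y n, K k -> (n < N)%N -> rel_pow P n.+1 (k, y) -> ~ S y) ->
    (forall x y z, rel_pow P M.+1 (x, y) -> ~ U y -> ~ rel_pow P N' (y, z)) ->
  rel_pow Q (M.+1 + N' + N) = set0.
Proof.
move=> QP KN KS PU.
(* a second jump needs a P-orbit from K to S of length at most N *)
have PK n k y : (n <= N)%N -> K k -> rel_pow Q n (k, y) -> rel_pow P n (k, y).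
  move=> + Kk; elim: n y => [//|n IHn] z nN; rewrite !rel_powS.
  move=> [y [/= /(IHn _ (ltnW nN)) ky]] /QP [[yz _]|[_ [w yw Sw]]].
    by exists y.
  suff : rel_pow P n.+1 (k, w) by move=> /(KS _ _ _ Kk nN).
  by rewrite rel_powS; exists y.
have noK k y : K k -> ~ rel_pow Q N (k, y).
  by move=> Kk /(PK _ _ _ (leqnn N) Kk); exact: KN.
(* an orbit with N more steps ahead cannot have jumped yet *)
have P_of_Q n x y z :
    rel_pow Q n (x, y) -> rel_pow Q N (y, z) -> rel_pow P n (x, y).
  elim: n y z => [//|n IHn] y z; rewrite !rel_powS => -[w [/= xw wy]] yz.
  have [v wv] : exists v, rel_pow Q N (w, v).
    apply: (@rel_pow_prefix _ _ 1 _ z); rewrite addnC rel_powD.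
    by exists y.
  case: (QP _ _ wy) => [[Pwy _]|[Ky _]]; last by case: (noK _ _ Ky yz).
  by exists w; split=> //; exact: IHn wv.
rewrite -subset0 => -[x z].
rewrite rel_powD => -[u [/= + uz]].
rewrite rel_powD => -[y [/= xy yu]].
have [v yv] : exists v, rel_pow Q N (y, v).
  apply: (@rel_pow_prefix _ _ N' _ z); rewrite addnC rel_powD.
  by exists u.
apply: (PU _ _ _ (P_of_Q _ _ _ _ xy yv) _ (P_of_Q _ _ _ _ yu uz)).
move: xy; rewrite rel_powS => -[w [_ /= /QP[[_ //]|[Ky _]]]].
by case: (noK _ _ Ky yv).
Qed.

End RelationPowers.

(** * Compactness *)

(** The conclusion is stated at a successor because powers of a relation are
    used with positive exponents. *)
Lemma compact_decreasing_empty {X : topologicalType} {A : set X}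
    {D : nat -> set X} : compact A ->
    (forall n, closed (D n)) -> (forall n, D n.+1 `<=` D n) ->
    A `&` \bigcap_n D n = set0 ->
  exists n, A `&` D n.+1 = set0.
Proof.
move=> /compact_near_coveringP cA clD decD AD0.
have leD m n : (m <= n)%N -> D n `<=` D m.
  elim: n => [|n IHn]; first by rewrite leqn0 => /eqP ->.
  rewrite leq_eqVlt => /orP[/eqP -> //|]; rewrite ltnS => /IHn.
  by apply: subset_trans; exact: decD.
have := cA nat \oo (fun n x => ~ D n x) _; case=> [x Ax|n _ /= /(_ n.+1)].
  have [m /not_implyP[_ Dmx]] : exists n, ~ (True -> D n x).
    apply/existsNP => Dx; suff : (A `&` \bigcap_n D n) x by rewrite AD0.
    by split=> // n _; exact: Dx.
  exists (~` D m, [set n | (m <= n)%N]) => /=.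
    split; last exact: nbhs_infty_ge.
    by apply: open_nbhs_nbhs; split=> //; exact: closed_openC.
  by move=> [y n] /= [Dmy mn] /leD - /(_ m mn).
move=> /(_ (leqnSn n)) AD; exists n; rewrite -subset0 => x [Ax].
exact: AD.
Qed.

(** Apply the near-covering form of compactness to the filter of eventually large
    finite subsets of [B]: a point of [B] at distance less than [r / 2] from [x]
    serves all points near [x]. *)
Lemma compact_finite_net {R : realType} {X : pseudoMetricType R} (A B : set X)
    (r : R) : compact A -> 0 < r ->
    (forall x d, A x -> 0 < d -> exists2 y, ball x d y & B y) ->
  exists K, [/\ finite_set K, K `<=` B &
    forall x, A x -> exists2 k, K k & ball k r x].
Proof.
move=> /compact_near_coveringP cA r0 AB.
pose I : set (set X) := [set K | finite_set K /\ K `<=` B].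
pose F := filter_from I (fun K => [set L | I L /\ K `<=` L]).
have FF : Filter F.
  apply: filter_from_filter => [|K L [finK KB] [finL LB]].
    by exists set0; split=> //; exact: finite_set0.
  exists (K `|` L).
    by split; [rewrite finite_setU | rewrite subUset].
  by move=> H [IH KLH]; split; split=> // y ?; apply: KLH; [left|right].
have [x Ax|K IK /(_ K)] :=
    cA _ F (fun K x => exists2 k, K k & ball k r x) FF.
  have r20 : 0 < r / 2 by rewrite divr_gt0.
  have [k xk Bk] := AB x _ Ax r20.
  exists (ball x (r / 2), [set L | I L /\ [set k] `<=` L]) => /=.
    split; first exact: nbhsx_ballx.
    by exists [set k] => //; split; [exact: finite_set1 | move=> _ ->].
  move=> [y L] /= [xy [_ kL]]; exists k; first exact: kL.
  by rewrite [r]splitr; apply: ball_triangle xy; exact: ball_sym.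
by move=> /(_ (conj IK (fun _ h => h))) AK; exists K; case: (IK) => ? ?; split.
Qed.

Lemma nowhere_dense_in_ball {R : realType} {X : pseudoMetricType R}
    {C A : set X} {x} {r : R} : nowhere_dense_in C A -> C x -> 0 < r ->
  exists2 y, ball x r y & (C `\` A) y.
Proof.
move=> [_ ndA] Cx r0; apply: contrapT => noy.
suff : @interior (subspace C) (@closure (subspace C) A) x by rewrite ndA.
apply: (@filterS _ (@nbhs _ (subspace C) x) _ A); first exact: subset_closure.
change (nbhs_subspace (x : subspace C) A); rewrite -nbhs_subspace_in//.
apply: filterS (nbhsx_ballx x r r0) => y xy Cy.
by apply: contrapT => nAy; apply: noy; exists y.
Qed.

Section CompactRelations.
Context {X : topologicalType}.
Hypotheses (hX : hausdorff_space X) (cX : compact [set: X]).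
Implicit Types (P Q : set (X * X)) (A B C : set X).

Let closed_compact {A} : closed A -> compact A.
Proof. by move=> clA; apply: subclosed_compact clA cX _. Qed.

Let compactXX : compact [set: X * X].
Proof. by rewrite -setXTT; exact: compact_setX. Qed.

Lemma closed_setX A B : closed A -> closed B -> closed (A `*` B).
Proof.
move=> clA clB; apply: closedI; apply: preimage_closed => // x _.
  exact: cvg_fst.
exact: cvg_snd.
Qed.

Lemma hausdorff_prod : hausdorff_space (X * X)%type.
Proof.
move=> [p1 p2] [q1 q2] pq; congr pair; apply: hX => A B Ap Bq.
  have [||x [[Ax _] [Bx _]]] := pq (A `*` setT) (B `*` setT).
  - by exists (A, setT) => //; split=> //; exact: filterT.
  - by exists (B, setT) => //; split=> //; exact: filterT.
  by exists x.1.
have [||x [[_ Ax] [_ Bx]]] := pq (setT `*` A) (setT `*` B).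
- by exists (setT, A) => //; split=> //; exact: filterT.
- by exists (setT, B) => //; split=> //; exact: filterT.
by exists x.2.
Qed.

Lemma closed_diagonal : closed (@diagonal X).
Proof.
move=> [x y] xy; apply: hX => A B Ax By.
have [|z [/= zE [Az Bz]]] := xy (A `*` B); first by exists (A, B).
by exists z.1; split=> //; rewrite zE.
Qed.

Lemma closed_image_compact {T : topologicalType} (f : T -> X) (D : set T) :
  compact [set: T] -> continuous f -> closed D -> closed (f @` D).
Proof.
move=> cT cf clD; apply: compact_closed => //; apply: continuous_compact.
  exact: continuous_subspaceT.
exact: subclosed_compact clD cT _.
Qed.

Lemma closed_fst_image P : closed P -> closed (fst @` P).
Proof. by apply: closed_image_compact => // x; exact: cvg_fst. Qed.

Lemma closed_snd_image P : closed P -> closed (snd @` P).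
Proof. by apply: closed_image_compact => // x; exact: cvg_snd. Qed.

Lemma closed_rel_image P A : closed P -> closed A -> closed (rel_image P A).
Proof.
move=> clP clA; rewrite (_ : rel_image P A = snd @` (P `&` A `*` setT)).
  by apply: closed_snd_image; apply: closedI => //; exact: closed_setX.
apply/seteqP; split=> [y [x Ax Pxy]|_ [[x y] [Pxy [Ax _]] <-]].
  by exists (x, y).
by exists x.
Qed.

Lemma closed_rel_inv P : closed P -> closed (rel_inv P).
Proof.
apply: (@preimage_closed _ _ (fun xy : X * X => (xy.2, xy.1))) => x _.
by apply: cvg_pair; [exact: cvg_snd | exact: cvg_fst].
Qed.

(** The composite is the projection, along the middle variable, of a closed set
    of triples. *)
Lemma closed_rel_comp P Q : closed P -> closed Q -> closed (rel_comp Q P).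
Proof.
move=> clP clQ.
pose T := (X * X * X)%type.
pose left (t : T) : X * X := (t.1.1, t.2).
pose right (t : T) : X * X := (t.2, t.1.2).
have c1 (t : T) : continuous_at t left.
  by apply: cvg_pair => /=; [apply: cvg_comp; exact: cvg_fst | exact: cvg_snd].
have c2 (t : T) : continuous_at t right.
  apply: cvg_pair => /=; first exact: cvg_snd.
  by apply: cvg_comp; [exact: cvg_fst | exact: cvg_snd].
rewrite (_ : rel_comp Q P = fst @` (left @^-1` P `&` right @^-1` Q)).
  apply: compact_closed.
    exact: hausdorff_prod.
  apply: continuous_compact.
    by apply: continuous_subspaceT => t; exact: cvg_fst.
  apply: (@subclosed_compact _ _ [set: T]) => //.
    by apply: closedI; apply: preimage_closed.
  by rewrite -setXTT; exact: compact_setX compactXX cX.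
apply/seteqP; split=> [[x z] [y [xy yz]]|_ [[[x z] y] [xy yz] <-]].
  by exists (x, z, y).
by exists y.
Qed.

Lemma closed_rel_restr P C : closed P -> closed C -> closed (rel_restr P C).
Proof. by move=> clP clC; apply: closedI => //; exact: closed_setX. Qed.

Lemma closed_rel_pow P n : closed P -> closed (rel_pow P n).
Proof.
move=> clP; elim: n => [|n IHn]; first exact: closed_diagonal.
by rewrite rel_powS; exact: closed_rel_comp.
Qed.

Lemma closed_C_plus P C : closed P -> closed C -> closed (C_plus P C).
Proof.
move=> clP clC; rewrite C_plusE; apply: closed_bigI => n _.
by apply: closed_fst_image; apply: closed_rel_pow; exact: closed_rel_restr.
Qed.

(** A closed set disjoint from [C_plus] misses one of the decreasing closed sets
    whose intersection is [C_plus], so the time to leave [C] is uniform on it. *)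
Lemma escape_C_plus {P C A} : closed P -> closed C -> closed A ->
    A `&` C_plus P C = set0 ->
  exists n, forall x y, A x -> ~ rel_pow (rel_restr P C) n.+1 (x, y).
Proof.
move=> clP clC clA; rewrite C_plusE => AC0.
have [||n An] := compact_decreasing_empty (closed_compact clA) _ _ AC0.
- move=> n; apply: closed_fst_image; apply: closed_rel_pow.
  exact: closed_rel_restr.
- move=> n _ [[x y] /= xy <-]; move: xy; rewrite -addn1 => /rel_pow_prefix[z].
  by exists (x, z).
exists n => x y Ax xy; suff : set0 x by [].
by rewrite -An; split=> //; exists (x, y).
Qed.

(** The same uniformity for backward orbits. *)
Lemma escape_C_minus {P C A} : closed P -> closed C -> closed A ->
    A `&` C_minus P C = set0 ->
  exists n, forall x y, A y -> ~ rel_pow (rel_restr P C) n.+1 (x, y).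
Proof.
move=> clP clC clA; rewrite C_minusE => AC0.
have [||n An] := compact_decreasing_empty (closed_compact clA) _ _ AC0.
- move=> n; apply: closed_snd_image; apply: closed_rel_pow.
  exact: closed_rel_restr.
- move=> n _ [[x y] /= xy <-]; move: xy; rewrite -addn1 addnC.
  by move=> /rel_pow_suffix[z]; exists (z, y).
exists n => x y Ay xy; suff : set0 y by [].
by rewrite -An; split=> //; exists (x, y).
Qed.

Lemma closed_neighborhood {A B} : closed A -> closed B -> A `&` B = set0 ->
  exists Z, [/\ closed Z, A `<=` interior Z & Z `&` B = set0].
Proof.
move=> clA clB AB0.
have [|V AV VB] := compact_normal hX cX clA (t := ~` B).
  move=> x Ax; apply: open_nbhs_nbhs; split; first exact: closed_openC.
  by move=> Bx; suff : set0 x by []; rewrite -AB0.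
exists (closure V); split; first exact: closed_closure.
  by move=> x Ax; apply: filterS (AV x Ax); exact: subset_closure.
by rewrite -subset0 => x [/VB].
Qed.

End CompactRelations.

(** * The perturbation *)

Section Perturbation.
Context {R : realType} {X : metricType R}.
Implicit Types (F : set (X * X)) (K S U : set X) (r : R).

(** Arrows of [F] into [U] are deleted; an arrow into [S] may instead end at a
    point of [K] close to its original target.  With [S] closed, [U] open and
    [K] finite, this is a finite union of closed sets. *)
Definition redirect F K S U r : set (X * X) :=
  (F `&` setT `*` ~` U) `|`
  \bigcup_(k in K) (rel_image (rel_inv F) (S `&` closed_ball k r) `*` [set k]).

Lemma closed_redirect F K S U r : compact [set: X] ->
  closed F -> finite_set K -> closed S -> open U -> closed (redirect F K S U r).
Proof.
move=> cX clF finK clS oU.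
have hX : hausdorff_space X := @metric_hausdorff R X.
apply: closedU.
  by apply: closedI => //; apply: closed_setX => //; exact: open_closedC.
apply: closed_bigcup => // k _; apply: closed_setX.
  apply: closed_rel_image => //; first exact: closed_rel_inv.
  by apply: closedI => //; exact: closed_ball_closed.
exact/accessible_closed_set1/hausdorff_accessible.
Qed.

Lemma redirectP {F K S U r x z} : redirect F K S U r (x, z) ->
  (F (x, z) /\ ~ U z) \/
  (K z /\ exists y, [/\ F (x, y), S y & closed_ball z r y]).
Proof.
move=> [[? [_ ?]]|[k Kk [/= [y [Sy ky] xy] ->]]]; first by left.
by right; split=> //; exists y.
Qed.

Lemma redirect_sub F K S U (e : R) : 0 < e ->
  redirect F K S U (e / 2) `<=` rel_comp (entourage_lt e) F.
Proof.
move=> e0 [x z] /redirectP[[Fxz _]|[_ [y [Fxy _ zy]]]].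
  by exists z; split=> //; rewrite /entourage_lt /= mdistxx.
exists y; split=> //; rewrite /entourage_lt /= metric_sym.
by have := subset_closure_half e0 zy; rewrite ballEmdist.
Qed.

Lemma sub_redirect F K S U (e : R) : 0 < e -> U `<=` S ->
    (forall x, U x -> exists2 k, K k & ball k (e / 2) x) ->
  F `<=` rel_comp (entourage_lt e) (redirect F K S U (e / 2)).
Proof.
move=> e0 US UK [x y] Fxy; have [Uy|nUy] := pselect (U y); last first.
  exists y; split; last by rewrite /entourage_lt /= mdistxx.
  by left.
have [k Kk ky] := UK _ Uy; exists k; split=> /=.
  right; exists k => //; split=> //=; exists y => //.
  by split; [exact: US | exact: subset_closed_ball].
by have := ky; rewrite ballEmdist /entourage_lt /= => /lt_trans; apply;
  rewrite ltr_pdivrMr// ltr_pMr// ltr1n.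
Qed.

End Perturbation.

(** * Destroying the isolated invariant set *)

Theorem theorem2p57 (R : realType) (X : metricType R)
    (F : set (X * X)) (C : set X) :
  compact [set: X] ->
  closed_relation F ->
  rel_dom F = [set: X] ->
  isolating_neighborhood F C ->
  nowhere_dense_in C (C_plus F C) ->
  forall e : R, 0 < e ->
  exists G : set (X * X),
    [/\ closed_relation G,
        rel_dom G = [set: X],
        G `<=` rel_comp (entourage_lt e) F,
        F `<=` rel_comp (entourage_lt e) G &
        (exists N : nat, (0 < N)%N /\ rel_pow (rel_restr G C) N = set0) /\
        [/\ C_minus G C = set0, C_plus G C = set0 & C_plusminus G C = set0]].
Proof.
move=> cX clF domF [clC isoC] ndC e e0.
have hX : hausdorff_space X := @metric_hausdorff R X.
have e20 : 0 < e / 2 by rewrite divr_gt0.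
have clFC : closed (rel_restr F C) by exact: closed_rel_restr.
have clA : closed (C_plus F C) by exact: closed_C_plus.
have clK : forall K : set X, finite_set K -> closed K.
  by apply/accessible_finite_set_closed; exact: hausdorff_accessible.
have [K [finK KC netK]] : exists K, [/\ finite_set K, K `<=` C `\` C_plus F C &
    forall x, C x -> exists2 k, K k & ball k (e / 2) x].
  apply: compact_finite_net => //; first exact: subclosed_compact clC cX _.
  by move=> x d Cx d0; exact: nowhere_dense_in_ball ndC Cx d0.
have [|N KN] := escape_C_plus hX cX clF clC (clK _ finK).
  by rewrite -subset0 => x [/KC[]].
have clbd : closed (C_plus F C `&` (C `&` ~` interior C)).
  apply: closedI => //; apply: closedI => //.
  exact/open_closedC/open_interior.
have [|M bdM] := escape_C_minus hX cX clF clC clbd.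
  rewrite -subset0 => x [[plusx [_ nCx]] minusx].
  by apply: nCx; apply: isoC; split.
pose EM := snd @` rel_pow (rel_restr F C) M.+1.
pose H := \bigcup_(i < N.+1) rel_image (rel_pow (rel_restr F C) i.+1) K.
(* the first set keeps later steps after a jump from reaching Z, the second
   keeps late points of an orbit in Z inside the interior of C *)
have [||Z [clZ CZ ZB]] := closed_neighborhood hX cX clA
    (B := H `|` (EM `&` (C `&` ~` interior C))).
- apply: closedU.
    apply: closed_bigcup => // i _; apply: closed_rel_image => //.
    + exact: closed_rel_pow.
    + exact: clK.
  apply: closedI; first by apply: closed_snd_image => //; exact: closed_rel_pow.
  by apply: closedI => //; exact/open_closedC/open_interior.
- rewrite -subset0 => y [plusy [[i _ [k Kk ky]]|[[[x z] /= xz zy] bdy]]].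
    (* y continues forever, hence so does the point k of K leading to y *)
    move: plusy; rewrite C_plusE => /(_ N.+1 I) [[w z] /= yz wy].
    rewrite {}wy in yz.
    have : rel_pow (rel_restr F C) (N.+1 + i.+1) (k, z).
      by rewrite addnC rel_powD; exists y.
    by move=> /rel_pow_prefix[v /KN]; case.
  by rewrite zy in xz; apply: (bdM _ _ _ xz).
have [||N' ZN'] := escape_C_plus hX cX clF clC (A := C `&` ~` interior Z).
- by apply: closedI => //; exact/open_closedC/open_interior.
- by rewrite -subset0 => x [[_ nZx] /CZ].
pose U := interior Z `&` interior C.
pose G := redirect F K (Z `&` C) U (e / 2).
have FG : F `<=` rel_comp (entourage_lt e) G.
  apply: sub_redirect => // x [Zx Cx].
    by split; exact: interior_subset.
  by apply: netK; exact: interior_subset.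
have GC0 : rel_pow (rel_restr G C) (M.+1 + N'.+1 + N.+1) = set0.
  apply: (@rel_pow_jump_set0 _ (rel_restr F C) _ K (Z `&` C) U).
  - move=> x z [/redirectP[[Fxz nUz]|[Kz [y [Fxy [Zy Cy] _]]]] [/= Cx Cz]].
      by left.
    by right; split=> //; exists y.
  - by move=> k y Kk; exact: KN.
  - move=> k y n Kk nN ky [Zy _]; suff : set0 y by [].
    by rewrite -ZB; split=> //; left; exists n => //; exists k.
  - move=> x y z xy nUy; apply: ZN'; have [_ Cy] := rel_pow_restr xy.
    split=> // Zy; suff : set0 y by [].
    rewrite -ZB; split; first exact: interior_subset.
    right; split; first by exists (x, y).
    by split=> // iCy; apply: nUy.
exists G; split => //.
- apply: closed_redirect => //; first exact: closedI.
  by apply: openI; exact: open_interior.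
- rewrite -subTset => x _.
  have [y [_ -> Fxy]] : rel_dom F x by rewrite domF.
  have [z [Gxz _]] := FG _ Fxy.
  by exists z; exists x.
- exact: redirect_sub.
- by split; [exists (M.+1 + N'.+1 + N.+1)%N | exact: rel_pow_set0_limits GC0].
Qed.
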